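(* Let $G=(V,E)$ be a finite simple graph in which every node has degree 3, with edge weights $\lambda:E\to[0,1]$ and $\mu(i)=0$ for all $i\in V$. For $v\in V$ let $n(v,1),n(v,2),n(v,3)$ denote the neighbors of $v$. For each $i\in V$ introduce new nodes and set $A_i=\{d_i,v_{i,n(i,1)},v_{i,n(i,2)},v_{i,n(i,3)}\}$ (all these nodes distinct, over all $i$), and let $E_i$ be the set of all 2-element subsets of $A_i$, so that $(A_i,E_i)$ is the complete graph on 4 vertices. Write $v_{ij}$ for $v_{i,j}$. Let $G'=(V',E')$ with $$V'=\bigcup_{i\in V}A_i,\qquad E'=\Big(\bigcup_{\{i,j\}\in E}\{\{v_{ij},v_{ji}\}\}\Big)\cup\Big(\bigcup_{i\in V}E_i\Big).$$ Define $\lambda'$ on $E'$ by $\lambda'(\{v_{ij},v_{ji}\})=\lambda(\{i,j\})$ for $\{i,j\}\in E$, $\lambda'(\{d_i,v_{ij}\})=1$, and $\lambda'(\{v_{ij},v_{ik}\})=1/3$. Let $\phi(\{i,j\})=\{v_{ij},v_{ji}\}$ for $\{i,j\}\in E$. If $X'$ is drawn from the weighted perfect matching distribution $\pi_{\mathrm{permat}}$ on $G'$ with edge weights $\lambda'$, and $X\in\{0,1\}^E$ is given by $X(e)=X'(\phi(e))$ for all $e\in E$, then $X$ has the subgraphs world distribution $\pi_{\mathrm{subs}}$ on $G$ with edge weights $\lambda$ and $\mu\equiv 0$.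
   Context: For a finite graph $G=(V,E)$, a configuration is $x\in\{0,1\}^E$, and the degree of node $i$ under $x$ is $\sum_{j:\{i,j\}\in E}x(\{i,j\})$. Empty products equal 1. A nonnegative weight function $w$ on $\{0,1\}^E$ defines the distribution $\pi(x)=w(x)/Z$, $Z=\sum_y w(y)$. Subgraphs world (a form of the Ising model) with parameters $\lambda(e)\in[0,1]$, $\mu(i)\in[0,1]$: $\pi_{\mathrm{subs}}$ is defined by the weight $$w_{\mathrm{subs}}(x)=\Big[\prod_{e:\,x(e)=1}\lambda(e)\Big]\Big[\prod_{i:\ \text{the degree of } i \text{ under } x \text{ is odd}}\mu(i)\Big].$$ Weighted perfect matchings with edge weights $\lambda(e)\ge 0$: $\pi_{\mathrm{permat}}$ is defined by the weight $w_{\mathrm{permat}}(x)=\prod_{e:x(e)=1}\lambda(e)$ if every node has degree exactly 1 under $x$, and $w_{\mathrm{permat}}(x)=0$ otherwise. *)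

(* Defs.v *)
From HB Require Import structures.
From mathcomp Require Import all_boot all_order all_algebra.
From mathcomp Require Import all_classical all_reals all_analysis.

Set Implicit Arguments.
Unset Strict Implicit.
Unset Printing Implicit Defensive.

Import Order.TTheory GRing.Theory Num.Theory.
Local Open Scope ring_scope.

(* A graph on the node type [V] is given by its edge set [E], a set of sets of
   nodes; all the definitions make sense for any [E], and theorems assume
   [simple_graph E]. *)

Notation edge E := {e : {set _} | e \in E}.

Notation config E := {ffun edge E -> bool}.

Definition simple_graph (V : finType) (E : {set {set V}}) : Prop :=
  forall e, e \in E -> #|e| = 2%N.

Definition neighbors (V : finType) (E : {set {set V}}) (i : V) : {set V} :=
  [set j | [set i; j] \in E].

(* The inner sum has one term if {i,j} is an edge and none otherwise. *)
Definition deg (V : finType) (E : {set {set V}}) (x : config E) (i : V) : nat :=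
  (\sum_(j : V) \sum_(e : edge E | val e == [set i; j]) x e)%N.

Section Distributions.
Variables (R : realType) (V : finType) (E : {set {set V}}).

Definition normalize (w : config E -> R) (x : config E) : R :=
  w x / \sum_(y : config E) w y.

Definition w_subs (lam : edge E -> R) (mu : V -> R) (x : config E) : R :=
  (\prod_(e : edge E | x e) lam e) * (\prod_(i : V | odd (deg x i)) mu i).

Definition pi_subs (lam : edge E -> R) (mu : V -> R) : config E -> R :=
  normalize (w_subs lam mu).

Definition w_permat (lam : edge E -> R) (x : config E) : R :=
  if [forall i : V, deg x i == 1%N] then \prod_(e : edge E | x e) lam e else 0.

Definition pi_permat (lam : edge E -> R) : config E -> R :=
  normalize (w_permat lam).

End Distributions.

(* [X] is a random element of the finite type [S], equipped with the discrete
   sigma-algebra, and its probability mass function is [p]. *)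
Definition has_law (d : measure_display) (T : measurableType d) (R : realType)
    (P : probability T R) (S : finType) (X : T -> S) (p : S -> R) : Prop :=
  forall s : S, measurable (X @^-1` [set s])%classic /\
                P (X @^-1` [set s])%classic = (p s)%:E.

(* The node d_i is encoded as (i, None), and v_{ij} as (i, Some j), the latter
   being present only if {i,j} is an edge. *)
Definition is_gnode (V : finType) (E : {set {set V}}) (p : V * option V) : bool :=
  if p.2 is Some j then [set p.1; j] \in E else true.

Notation gnode E := {p : _ * option _ | is_gnode E p}.

Section Gadget.
Variables (V : finType) (E : {set {set V}}).

Definition dnode (i : V) : gnode E := Sub (i, None) isT.

Definition vnode (i j : V) (ij : [set i; j] \in E) : gnode E :=
  Sub (i, Some j) (ij : is_gnode E (i, Some j)).

Definition block (i : V) : {set gnode E} := [set u | (val u).1 == i].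

Definition block_edges (i : V) : {set {set gnode E}} :=
  [set e : {set gnode E} | (e \subset block i) && (#|e| == 2%N)].

(* The set of all v_{ij} such that {i,j} = e, i.e. {v_{ij}, v_{ji}}; see
   [phi_setE]. *)
Definition phi_set (e : {set V}) : {set gnode E} :=
  [set u : gnode E | if (val u).2 is Some j then [set (val u).1; j] == e
                     else false].

Definition gadget : {set {set gnode E}} :=
  [set phi_set e | e in E] :|: \bigcup_(i : V) block_edges i.

Lemma phi_subproof (e : edge E) : phi_set (val e) \in gadget.
Proof. by rewrite inE imset_f //; exact: valP. Qed.

Definition phi (e : edge E) : edge gadget :=
  Sub (phi_set (val e)) (phi_subproof e).

(* See [gadget_weight_phi], [gadget_weight_dv] and [gadget_weight_vv] for the
   values on the three kinds of edges. *)
Definition gadget_weight (R : realType) (lam : edge E -> R)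
    (e' : edge gadget) : R :=
  if [pick e | phi e == e'] is Some e then lam e
  else if [exists i, dnode i \in val e'] then 1 else 1 / 3.

Lemma phi_setE (i j : V) (ij : [set i; j] \in E) (ji : [set j; i] \in E) :
  phi_set [set i; j] = [set vnode ij; vnode ji].
Proof.
apply/setP => -[[a [b|]] ab]; rewrite !inE -!val_eqE /= !xpair_eqE //=.
- rewrite !(inj_eq Some_inj).
  apply/eqP/orP => [abij|[]/andP[/eqP-> /eqP->] //]; last by rewrite finset.setUC.
  have /setP abijE := abij; have := abijE j; have := abijE i.
  have := abijE b; have := abijE a.
  rewrite !inE !eqxx !orbT (eq_sym i a) (eq_sym i b) (eq_sym j a) (eq_sym j b).
  by case: (a == i); case: (a == j); case: (b == i); case: (b == j); auto.
- by rewrite !andbF.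
Qed.

Lemma phi_set_dv (e : {set V}) (i : V) : (dnode i \in phi_set e) = false.
Proof. by rewrite inE. Qed.

Lemma card_block (i : V) : #|block i| = #|neighbors E i|.+1.
Proof.
rewrite (cardsD1 (dnode i)) inE eqxx add1n; congr _.+1.
rewrite -(card_imset (mem (neighbors E i)) Some_inj).
pose f := fun u : gnode E => (val u).2.
rewrite -(@card_in_imset _ _ f).
  apply: eq_card => o; apply/imsetP/imsetP.
    move=> [[[a [b|]] ab]]; rewrite !inE -val_eqE /= xpair_eqE.
      by rewrite andbF /= => /eqP <- ->; exists b => //; rewrite inE.
    by rewrite eqxx andbT andNb.
  case=> b; rewrite inE => ib ->; exists (vnode ib) => //.
  by rewrite !inE -val_eqE /= xpair_eqE andbF /=.
move=> [[a oa] pa] [[b ob] pb]; rewrite !inE /= => /andP[_ /eqP ai].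
by move=> /andP[_ /eqP bi]; rewrite /f /= => ab; apply/val_inj; rewrite /= ai bi ab.
Qed.

Lemma simple_edgeP (e : {set V}) : simple_graph E -> e \in E ->
  exists i j (ij : [set i; j] \in E) (ji : [set j; i] \in E),
    [/\ i != j, e = [set i; j] & phi_set e = [set vnode ij; vnode ji]].
Proof.
move=> sE eE; have /cards2P[i [j [ij eij]]] : #|e| == 2%N by rewrite sE.
have ijE : [set i; j] \in E by rewrite -eij.
have jiE : [set j; i] \in E by rewrite finset.setUC -eij.
by exists i, j, ijE, jiE; rewrite eij -phi_setE.
Qed.

Lemma phi_inj : simple_graph E -> injective phi.
Proof.
move=> sE e f /(congr1 val) ef; apply/val_inj.
have [i [j [ij [ji [_ eE h]]]]] := simple_edgeP sE (valP e); rewrite eE.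
have : vnode ij \in phi_set (val e) by rewrite h set21.
by rewrite (ef : phi_set (val e) = phi_set (val f)) inE => /eqP.
Qed.

Lemma gadget_simple : simple_graph E -> simple_graph gadget.
Proof.
move=> sE e'; rewrite inE => /orP[/imsetP[e eE ->]|/bigcupP[i _]]; last first.
  by rewrite inE => /andP[_ /eqP].
have [i [j [ij [ji [nij _ ->]]]]] := simple_edgeP sE eE.
by rewrite cards2 -val_eqE /= xpair_eqE negb_and nij.
Qed.

Lemma gadget_weight_phi (R : realType) (lam : edge E -> R) (e : edge E) :
  simple_graph E -> gadget_weight lam (phi e) = lam e.
Proof.
move=> sE; rewrite /gadget_weight; case: pickP => [e0 /eqP/phi_inj -> //|/(_ e)].
by rewrite eqxx.
Qed.

Lemma gadget_weight_dv (R : realType) (lam : edge E -> R) (i j : V)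
    (ij : [set i; j] \in E) (e' : edge gadget) :
  val e' = [set dnode i; vnode ij] -> gadget_weight lam e' = 1.
Proof.
move=> e'E; rewrite /gadget_weight; case: pickP => [e /eqP ee'|_].
  by have := set21 (dnode i) (vnode ij); rewrite -e'E -ee' phi_set_dv.
by case: existsP => // -[]; exists i; rewrite e'E set21.
Qed.

Lemma gadget_weight_vv (R : realType) (lam : edge E -> R) (i j k : V)
    (ij : [set i; j] \in E) (ik : [set i; k] \in E) (e' : edge gadget) :
  simple_graph E -> j != k ->
  val e' = [set vnode ij; vnode ik] -> gadget_weight lam e' = 1 / 3.
Proof.
move=> sE jk e'E; rewrite /gadget_weight; case: pickP => [e /eqP ee'|_].
  have := set21 (vnode ij) (vnode ik); have := set22 (vnode ij) (vnode ik).
  rewrite -e'E -ee' !inE /= => /eqP <- /eqP/setP/(_ j).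
  rewrite !inE eqxx orbT (negbTE jk) orbF => /esym/eqP ji.
  by have := sE _ ij; rewrite ji finset.setUid cards1.
case: existsP => // -[a]; rewrite e'E !inE -!val_eqE /= !xpair_eqE !andbF //.
Qed.

End Gadget.

(* Main.v *)
(* Fix [x] on [E].  A perfect matching of the gadget graph restricting to [x]
   matches d_i with some v_{ij} such that x({i,j}) = 0; there are 3 - deg x i
   such j, and once g i = j is chosen, the remaining ones must be matched with
   each other inside the block of i.  This is possible iff deg x i is 0 or 2,
   and the matching inside the block then has weight 1/3 or 1, which is the
   inverse of the number of choices for g i.  Hence each block contributes a
   total weight 1, and summing over g leaves the product of the lambda(e) with
   x(e) = 1 if all degrees are even, and 0 otherwise. *)
Require Import Defs.
From mathcomp Require Import all_boot all_order all_algebra.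
From mathcomp Require Import all_classical all_reals all_analysis.

Import Order.TTheory GRing.Theory Num.Theory.
Local Open Scope ring_scope.

Set Implicit Arguments.
Unset Strict Implicit.
Unset Printing Implicit Defensive.

(** * Small finite sets, and the law of a function of a random element *)

Lemma set2_inj (U : finType) (a b c d : U) : [set a; b] = [set c; d] ->
  (a = c /\ b = d) \/ (a = d /\ b = c).
Proof.
move=> /setP abcd; have := abcd d; have := abcd c; have := abcd b.
have := abcd a; rewrite !inE !eqxx !orbT /= => /esym/orP[]/eqP ->.
  move=> /esym/orP[]/eqP -> _; last by left.
  by rewrite orbb => /eqP ->; left.
move=> /esym/orP[]/eqP ->; first by right.
by rewrite orbb => /eqP ->; left.
Qed.

Lemma card3_set3 (U : finType) (A : {set U}) (a b c : U) : #|A| = 3%N ->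
  a \in A -> b \in A -> c \in A -> a != b -> a != c -> b != c ->
  A = [set a; b; c].
Proof.
move=> A3 aA bA cA ab ac bc; apply/esym/eqP; rewrite eqEcard A3.
apply/andP; split.
  by apply/fintype.subsetP => z; rewrite !inE => /orP[/orP[]|] /eqP ->.
rewrite finset.setUC cardsU1 cards2 !inE ab eq_sym (negbTE ac).
by rewrite eq_sym (negbTE bc).
Qed.

Definition mk_edge (U : finType) (G : {set {set U}}) (e : {set U})
    (eG : e \in G) : edge G :=
  Sub e eG.

(** The event that [h \o X] equals [s] is the finite disjoint union of the events that [X] equals
    [y], for [y] in the fibre of [h] over [s]; additivity of [P] gives the sum. *)
Lemma has_law_comp (d : measure_display) (T : measurableType d) (R : realType)
    (P : probability T R) (S S' : finType) (X : T -> S) (p : S -> R)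
    (h : S -> S') :
  has_law P X p -> has_law P (h \o X) (fun s => \sum_(y | h y == s) p y).
Proof.
move=> Xp s; have preimE : ((h \o X) @^-1` [set s] =
    \bigcup_(y in [set` [pred y | h y == s]]) X @^-1` [set y])%classic.
  apply/seteqP; split => t /= => [hXt|[y /eqP <- <-] //].
  by exists (X t) => //=; apply/eqP.
rewrite preimE; split.
  apply: fin_bigcup_measurable => [|y _]; first exact: finite_finset.
  exact: (Xp y).1.
rewrite measure_fin_bigcup.
- rewrite -(bigfs _ (index_enum_uniq S)) => [|y _]; last first.
    by rewrite mem_index_enum.
  by rewrite -sumEFin; apply: eq_bigr => y _; exact: (Xp y).2.
- exact: finite_finset.
- exact: trivIset_preimage1.
- by move=> y _; exact: (Xp y).1.
Qed.

(** * Configurations as symmetric relations on nodes *)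

Section Adjacency.
Variables (U : finType) (G : {set {set U}}).
Implicit Types (y : config G) (u v : U).

(** Being false off the edges of [G], this relation can be evaluated at any two nodes without a
    proof that they form an edge. *)
Definition adj y u v : bool :=
  [exists e : edge G, (val e == [set u; v]) && y e].

Lemma adjE y (e : edge G) u v : val e = [set u; v] -> adj y u v = y e.
Proof.
move=> euv; apply/existsP/idP => [[f /andP[/eqP fuv]]|ye].
  by rewrite (_ : f = e) //; apply/val_inj; rewrite fuv euv.
by exists e; rewrite euv eqxx.
Qed.

Lemma adjC y u v : adj y u v = adj y v u.
Proof. by rewrite /adj finset.setUC. Qed.

Lemma adj_edge y u v : adj y u v -> [set u; v] \in G.
Proof. by case/existsP => e /andP[/eqP <- _]; exact: valP. Qed.

Lemma degE y u : deg y u = #|[pred v | adj y u v]|.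
Proof.
rewrite /deg -sum1_card [RHS]big_mkcond /=; apply: eq_bigr => v _.
have [uvG|uvG] := boolP ([set u; v] \in G).
  rewrite (big_pred1 (mk_edge uvG)) => [|e]; last by rewrite -val_eqE.
  by rewrite inE (@adjE y (mk_edge uvG) u v) //; case: (y _).
rewrite big_pred0 => [|e]; last first.
  by apply: contraNF uvG => /eqP <-; exact: valP.
by rewrite inE; case: ifP => // /adj_edge; rewrite (negbTE uvG).
Qed.


Lemma deg1P y u :
  reflect (exists v, forall w, adj y u w = (w == v)) (deg y u == 1%N).
Proof. by rewrite degE; exact: card1P. Qed.

Lemma edge_neq u v : simple_graph G -> [set u; v] \in G -> u != v.
Proof.
move=> sG /sG uvG; apply/eqP => uv; rewrite uv finset.setUid cards1 in uvG.
by [].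
Qed.

Lemma edge_set2 (e : edge G) : simple_graph G -> exists u v, val e = [set u; v].
Proof.
move=> sG; have /cards2P[u [v [_ ->]]] : #|val e| == 2%N.
  by rewrite (sG _ (valP e)).
by exists u, v.
Qed.

End Adjacency.

(** * Perfect matchings of the gadget graph that restrict to a given [x] *)

Section Matchings.
Variables (V : finType) (E : {set {set V}}).
Hypothesis simpleE : simple_graph E.
Hypothesis cubicE : forall i : V, #|neighbors E i| = 3%N.
Implicit Types (x : config E) (y : config (gadget E)) (g : {ffun V -> V}).
Implicit Types (u v : gnode E).

(** In coordinates, an edge inside a block joins two distinct nodes with equal first component, and
    an edge in the image of [phi] joins (i, Some j) to (j, Some i). *)
Lemma gadget_pair u v : ([set u; v] \in gadget E) =
  ((val u).1 == (val v).1) && ((val u).2 != (val v).2)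
  || ((val u).2 == Some (val v).1) && ((val v).2 == Some (val u).1).
Proof.
rewrite inE; apply/idP/idP => [/orP[/imsetP[e eE]|/bigcupP[i _]]|].
- have [i [j [ij [ji [_ _ ->]]]]] := simple_edgeP simpleE eE.
  by move=> /set2_inj[] [-> ->] /=; rewrite !eqxx orbT.
- rewrite inE => /andP[/fintype.subsetP uvi /eqP].
  have /eqP ui : (val u).1 == i by have := uvi u (set21 _ _); rewrite inE.
  have /eqP vi : (val v).1 == i by have := uvi v (set22 _ _); rewrite inE.
  rewrite cards2 ui vi eqxx /=; case: (eqVneq u v) => //= + _.
  by rewrite -val_eqE -pair_eqE /pair_eq /= ui vi eqxx /= => ->.
- case/orP => [/andP[/eqP uv1 uv2]|/andP[/eqP uv /eqP vu]]; apply/orP.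
    right; apply/bigcupP; exists (val u).1 => //; rewrite inE cards2.
    apply/andP; split; first apply/fintype.subsetP => w.
      by rewrite !inE => /orP[] /eqP ->; rewrite ?uv1.
    by rewrite -val_eqE -pair_eqE /pair_eq /= uv1 eqxx uv2.
  left; have uE := valP u; have vE := valP v; rewrite /is_gnode uv in uE.
  rewrite /is_gnode vu in vE.
  apply/imsetP; exists [set (val u).1; (val v).1] => //.
  rewrite (phi_setE uE vE); congr [set _; _]; apply/val_inj => /=.
    by rewrite -uv -surjective_pairing.
  by rewrite -vu -surjective_pairing.
Qed.

Definition restr y : config E := [ffun e => y (phi e)].

Lemma adj_restr y u v :
  (val u).2 = Some (val v).1 -> (val v).2 = Some (val u).1 ->
  adj y u v = adj (restr y) (val u).1 (val v).1.
Proof.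
move=> uv vu; have uE := valP u; have vE := valP v; rewrite /is_gnode uv in uE.
rewrite /is_gnode vu in vE.
rewrite (@adjE _ _ _ (mk_edge uE)) // ffunE; apply: adjE.
rewrite /= (phi_setE uE vE); congr [set _; _]; apply/val_inj => /=.
  by rewrite -uv -surjective_pairing.
by rewrite -vu -surjective_pairing.
Qed.

(** The neighbors j for which v_{ij} is not matched to v_{ji} and so needs a partner inside the
    block of i. *)
Definition free x i := [set j in neighbors E i | ~~ adj x i j].

Lemma deg_free x i : (deg x i + #|free x i|)%N = 3%N.
Proof.
rewrite -(cubicE i) degE -(cardID [pred j | adj x i j] (neighbors E i)).
congr (_ + _)%N; apply: eq_card => j; rewrite !inE; last by rewrite andbC.
by case: (boolP (adj x i j)) => [/adj_edge ->|]; rewrite ?andbF.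
Qed.

(** Once d_i takes v_{i, g i}, these are the j whose v_{ij} have only each other as possible
    partners. *)
Definition rest x g i := free x i :\ g i.

(* Adjacency in the perfect matching determined by [x] and by the choice of the
   partner v_{i, g i} of each d_i. *)
Definition link x g u v : bool :=
  match val u, val v with
  | (_, None), (_, None) => false
  | (i, None), (k, Some l) => (i == k) && (l == g i)
  | (i, Some j), (k, None) => (i == k) && (j == g i)
  | (i, Some j), (k, Some l) =>
      if i == k then [&& j != l, j \in rest x g i & l \in rest x g i]
      else [&& adj x i j, j == k & l == i]
  end.

Lemma linkC x g u v : link x g u v = link x g v u.
Proof.
rewrite /link; case: (val u) (val v) => [i [j|]] [k [l|]] //; last 2 first.
- by rewrite eq_sym; case: eqVneq => // ->.
- by rewrite eq_sym; case: eqVneq => // ->.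
rewrite (eq_sym k); case: eqVneq => [->|_].
  by rewrite eq_sym; congr (_ && _); exact: andbC.
case: (eqVneq j k) => [->|]; case: (eqVneq l i) => [->|];
  rewrite ?andbF ?andbT //=.
by rewrite adjC.
Qed.

Lemma link_edge x g u v : (forall i, g i \in free x i) ->
  link x g u v -> [set u; v] \in gadget E.
Proof.
move=> gF; rewrite gadget_pair /link.
case: (val u) (val v) => [i [j|]] [k [l|]] //=.
- case: ifP => _ => [/and3P[jl _ _]|/and3P[_ /eqP -> /eqP ->]].
    by rewrite (inj_eq Some_inj) jl.
  by rewrite !eqxx orbT.
- by case/andP => ->.
- by case/andP => ->.
Qed.

Definition matching x g : config (gadget E) :=
  [ffun e' => [exists u, exists v, (val e' == [set u; v]) && link x g u v]].

Lemma adj_matching x g u v : (forall i, g i \in free x i) ->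
  adj (matching x g) u v = link x g u v.
Proof.
move=> gF; apply/idP/idP.
  case/existsP => e' /andP[/eqP e'E]; rewrite ffunE.
  case/existsP => a /existsP[b /andP[]]; rewrite e'E => /eqP /set2_inj.
  by case=> [[-> ->]|[-> ->]] //; rewrite linkC.
move=> uvl; apply/existsP; exists (mk_edge (link_edge gF uvl)) => /=.
rewrite eqxx ffunE; apply/existsP; exists u; apply/existsP; exists v.
by rewrite eqxx.
Qed.

(** The choice [g i] can be read off the matching as the partner of d_i. *)
Lemma matching_inj x g g' : (forall i, g i \in free x i) ->
  (forall i, g' i \in free x i) -> matching x g = matching x g' -> g = g'.
Proof.
move=> gF g'F gg'; apply/ffunP => i.
have giE : [set i; g i] \in E by have := gF i; rewrite !inE => /andP[].
have := adj_matching (dnode E i) (vnode giE) gF.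
by rewrite gg' adj_matching // /link /= !eqxx /= => /eqP.
Qed.

Lemma restr_matching x g : (forall i, g i \in free x i) ->
  restr (matching x g) = x.
Proof.
move=> gF; apply/ffunP => e; rewrite ffunE.
have [i [j [ij [ji [nij eE phiE]]]]] := simple_edgeP simpleE (valP e).
rewrite -(@adjE _ _ _ (phi e) (vnode ij) (vnode ji)) // adj_matching //.
by rewrite /link /= (negbTE nij) !eqxx !andbT (adjE x eE).
Qed.

(** The unique partner is v_{i, g i} for d_i; for v_{ij} it is v_{ji} if j is not free, d_i if j is
    [g i], and otherwise the node of the one remaining free neighbor. *)
Lemma matching_perfect x g u : (forall i, ~~ odd (deg x i)) ->
  (forall i, g i \in free x i) -> deg (matching x g) u == 1%N.
Proof.
move=> evx gF; apply/deg1P.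
suff [v uv] : exists v, forall w, link x g u w = (w == v).
  by exists v => w; rewrite adj_matching.
case: u => -[i [j|]] uE; last first.
  have giE : [set i; g i] \in E by have := gF i; rewrite !inE => /andP[].
  exists (vnode giE) => -[[k [l|]] wE];
    rewrite -val_eqE /link /= !xpair_eqE eq_sym.
    by case: eqP.
  by rewrite andbF.
have ijE : [set i; j] \in E := uE.
have [jF|jF] := boolP (j \in free x i); last first.
  have ijx : adj x i j by move: jF; rewrite !inE ijE /= negbK.
  have jiE : [set j; i] \in E by rewrite finset.setUC.
  exists (vnode jiE) => -[[k [l|]] wE]; rewrite -val_eqE /link /= !xpair_eqE.
    rewrite ijx /= (eq_sym k j); case: (eqVneq i k) => // <-.
    by rewrite !inE ijx !andbF (eq_sym j i) (negbTE (edge_neq simpleE ijE)).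
  rewrite andbF; case: (eqVneq j (g i)) => [jg|]; rewrite ?andbF //.
  by have := gF i; rewrite -jg (negbTE jF).
have [jg|jg] := eqVneq j (g i).
  exists (dnode E i) => -[[k [l|]] wE]; rewrite -val_eqE /link /= !xpair_eqE.
    rewrite !inE -jg eqxx /= andbF andbF; case: eqP => // _.
    by move: jF; rewrite inE => /andP[_ /negbTE ->].
  by rewrite jg eqxx eq_sym.
(* Both j and [g i] are free, so the degree is at most 1; being even, it is 0 and all three
   neighbors are free. Exactly one of them, l below, is left as partner of j. *)
have F3 : #|free x i| = 3%N.
  have := deg_free x i; have := evx i.
  have : (1 < #|free x i|)%N by apply/card_gt1P; exists j, (g i).
  by case: #|_| => [|[|[|[|n]]]] //; case: (deg x i) => [|[|[|[|m]]]].
have R1 : #|free x i :\: [set j; g i]| = 1%N.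
  rewrite cardsD (finset.setIidPr _) ?F3 ?cards2 ?jg //.
  apply/fintype.subsetP => z; rewrite !inE => /orP[] /eqP ->.
    by move: jF; rewrite !inE.
  by move: (gF i); rewrite !inE.
have /eqP/cards1P[l lE] := R1.
have : l \in free x i :\: [set j; g i] by rewrite lE set11.
have ijx : adj x i j = false by move: jF; rewrite inE => /andP[_ /negbTE ->].
rewrite !inE negb_or => /andP[/andP[lj lg] /andP[ilE ilx]].
exists (vnode ilE) => -[[k [m|]] wE]; rewrite -val_eqE /link /= !xpair_eqE.
  rewrite (eq_sym i k) ijx; case: eqP => // _.
  transitivity (m \in [set l]); last by rewrite finset.in_set1.
  rewrite -lE !inE jg.
  move: jF; rewrite !inE => -> /=.
  by rewrite negb_or (eq_sym j) andbA.
by rewrite (negbTE jg) !andbF.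
Qed.

(** Converse of the construction: [g] is read off from the partners of the d_i, and uniqueness of
    partners in blocks of four nodes forces everything else. The parity clause excludes odd degrees
    in the restriction. *)
Lemma perfect_link y : (forall u, deg y u == 1%N) ->
  exists g, [/\ forall i, g i \in free (restr y) i,
    forall i, odd #|free (restr y) i| &
    forall u v, adj y u v = link (restr y) g u v].
Proof.
set x := restr y => y1.
have uniq_adj u v w : adj y u v -> adj y u w -> v = w.
  by have /deg1P[z uz] := y1 u; rewrite !uz => /eqP -> /eqP.
(* If {i,j} were selected by [x], then v_{ij} would have v_{ji}, in another block, as a second
   partner. *)
have free_adj i j l u v : val u = (i, Some j) -> val v = (i, l) -> adj y u v ->
    j \in free x i.
  move=> uE vE uv; have ijE : [set i; j] \in E by have := valP u; rewrite uE.
  rewrite !inE ijE /=; apply/negP => ijx.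
  have jiE : [set j; i] \in E by rewrite finset.setUC.
  have : adj y u (vnode jiE) by rewrite adj_restr ?uE.
  move=> /(uniq_adj _ _ _ uv) vji; move: vE (edge_neq simpleE ijE).
  rewrite vji /=.
  by case=> -> _; rewrite eqxx.
(* No edge leaves the block of i at d_i, so its partner is some v_{ij}. *)
have dP i : exists j, forall v, adj y (dnode E i) v = (val v == (i, Some j)).
  have /deg1P[w dw] := y1 (dnode E i); have : adj y (dnode E i) w by rewrite dw.
  move=> /adj_edge; rewrite gadget_pair /= orbF.
  case: w dw => -[k [j|]] wE dw /= /andP[/eqP ik // _].
  by exists j => v; rewrite dw -val_eqE /= ik.
have [g0 g0P] := fin_all_exists dP.
pose g : {ffun V -> V} := [ffun i => g0 i].
have gP i v : adj y (dnode E i) v = (val v == (i, Some (g i))) by rewrite ffunE.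
have gF i : g i \in free x i.
  have /deg1P[w dw] := y1 (dnode E i).
  have dw1 : adj y (dnode E i) w by rewrite dw.
  have := dw1; rewrite gP => /eqP wE.
  apply: (free_adj _ _ None w (dnode E i)) => //.
  by rewrite adjC.
have restP i j l u v : val u = (i, Some j) -> val v = (i, Some l) ->
    adj y u v -> [&& j != l, j \in rest x g i & l \in rest x g i].
  move=> uE vE uv; rewrite !finset.in_setD1 (free_adj _ _ _ _ _ uE vE uv).
  rewrite adjC in uv; rewrite (free_adj _ _ _ _ _ vE uE uv) !andbT.
  apply/and3P; split.
  - have := edge_neq (gadget_simple simpleE) (adj_edge uv).
    by apply: contraNneq => jl; apply/eqP/val_inj; rewrite uE vE jl.
  - apply/eqP => jg; rewrite adjC in uv.
    have : adj y u (dnode E i) by rewrite adjC gP uE jg.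
    by move=> /(uniq_adj _ _ _ uv) vd; rewrite vd in vE.
  - apply/eqP => lg.
    have : adj y v (dnode E i) by rewrite adjC gP vE lg.
    by move=> /(uniq_adj _ _ _ uv) ud; rewrite ud in uE.
(* The partner of v_{ij} is neither d_i, which is taken by v_{i, g i}, nor v_{ji}, because j is
   free; it is therefore some v_{il}. *)
have partner i j : j \in rest x g i -> exists l (ij : [set i; j] \in E)
   (il : [set i; l] \in E), adj y (vnode ij) (vnode il).
  rewrite !inE => /and3P[jg ijE ijx].
  have /deg1P[w jw] := y1 (vnode ijE).
  have {jw} : adj y (vnode ijE) w by rewrite jw.
  case: w => -[k [l|]] wE jw; last first.
    have : adj y (dnode E k) (vnode ijE).
      by rewrite adjC; move: jw; congr adj; apply/val_inj.
    rewrite gP /= xpair_eqE => /andP[/eqP ik /eqP[jgk]].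
    by rewrite jgk ik eqxx in jg.
  have := adj_edge jw; rewrite gadget_pair /= => /orP[/andP[/eqP ik _]|].
    subst k; exists l, ijE, wE; move: jw; congr adj; exact/val_inj.
  case/andP => /eqP[jk] /eqP[li]; subst k l; move: jw.
  by rewrite adj_restr //= (negbTE ijx).
exists g; split => // [i|u v].
  (* Either [g i] is the only free neighbor, or some j in [rest] and its partner l join it to make
     three. *)
  have [R0|] := set_0Vmem (rest x g i).
    by rewrite (cardsD1 (g i)) gF -/(rest x g i) R0 cards0.
  case=> j jR; have [l [ij [il jl]]] := partner _ _ jR.
  have /and3P[njl _ lR] := restP i j l (vnode ij) (vnode il) erefl erefl jl.
  have [/andP[jg jF] /andP[lg lF]] :
      (j != g i) && (j \in free x i) /\ (l != g i) && (l \in free x i).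
    by rewrite -!finset.in_setD1.
  suff -> : #|free x i| = 3%N by [].
  apply/eqP; rewrite eqn_leq -{1}(deg_free x i) leq_addl /=.
  apply/card_gt2P; exists (g i), j, l; split => //.
  by rewrite eq_sym jg njl lg.
case uE: (val u) => [i [j|]]; case vE: (val v) => [k [l|]];
  rewrite /link uE vE; last first.
- apply: contraTF isT => /adj_edge; rewrite gadget_pair uE vE /=.
  by rewrite andbF.
- rewrite (_ : u = dnode E i); last exact/val_inj.
  by rewrite gP vE xpair_eqE eq_sym.
- rewrite adjC (_ : v = dnode E k); last exact/val_inj.
  by rewrite gP uE xpair_eqE; case: eqVneq => // ->.
case: (eqVneq i k) => [ik|ik].
  subst k; apply/idP/idP => [|/and3P[jl jR lR]]; first exact: restP.
  have [m [ij [im jm]]] := partner _ _ jR.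
  have /and3P[njm _ mR] := restP i j m (vnode ij) (vnode im) erefl erefl jm.
  have [/andP[jg jF] [/andP[lg lF] /andP[mg mF]]] :
    (j != g i) && (j \in free x i) /\
   ((l != g i) && (l \in free x i) /\ (m != g i) && (m \in free x i)).
    by rewrite -!finset.in_setD1.
  have FN z : z \in free x i -> z \in neighbors E i by rewrite inE => /andP[].
  (* The three neighbors of i are [g i], j and l. The actual partner index m of j differs from [g i]
     and from j, hence is l. *)
  have := card3_set3 (cubicE i) (FN _ (gF i)) (FN _ jF) (FN _ lF).
  rewrite eq_sym jg eq_sym lg => /(_ isT isT jl)/setP/(_ m).
  rewrite (FN _ mF) !inE (negbTE mg) eq_sym (negbTE njm) /= => /esym/eqP ml.
  subst m; move: jm; congr adj; apply/val_inj => /=; by rewrite ?uE ?vE.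
apply/idP/and3P => [uv|[ijx /eqP jk /eqP li]].
  have := adj_edge uv; rewrite gadget_pair uE vE /= (negbTE ik) /=.
  case/andP => /eqP[jk] /eqP[li]; split; rewrite ?jk ?li //.
  by move: uv; rewrite adj_restr ?uE ?vE ?jk ?li.
by rewrite adj_restr ?uE ?vE ?jk ?li //= -jk.
Qed.


(** * Sorting the edges of the gadget graph by block *)

Lemma phi_notin_block (e : edge E) i : ~~ (val (phi e) \subset block E i).
Proof.
have [j [k [jk [kj [njk _ phiE]]]]] := simple_edgeP simpleE (valP e).
apply/negP; rewrite /= phiE => /fintype.subsetP jki.
have := jki _ (set21 _ _); have := jki _ (set22 _ _).
by rewrite !inE /= => /eqP ki /eqP ji; rewrite ji ki eqxx in njk.
Qed.

(** Blocks are disjoint and edges nonempty, so an edge outside the image of [phi] has one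
    well-defined block; this lets a product over such edges be split by block. *)
Lemma gadget_edgeP (e' : edge (gadget E)) : ~~ [exists e, phi e == e'] ->
  exists i, forall k, (val e' \subset block E k) = (k == i).
Proof.
move=> e'phi; have := valP e'; rewrite inE => /orP[/imsetP[e eE e'E]|].
  case/existsP: e'phi; exists (mk_edge eE); apply/eqP/val_inj => /=.
  by rewrite e'E.
case/bigcupP => i _; rewrite inE => /andP[e'i e'2]; exists i => k.
apply/idP/eqP => [e'k|-> //].
have /card_gt0P[u ue'] : (0 < #|val e'|)%N by rewrite (eqP e'2).
have := fintype.subsetP e'i u ue'; have := fintype.subsetP e'k u ue'.
by rewrite !inE => /eqP <- /eqP <-.
Qed.

Lemma matching_block x g i (e' : edge (gadget E)) :
  matching x g e' -> val e' \subset block E i ->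
  (exists j (ij : [set i; j] \in E), val e' = [set dnode E i; vnode ij]) \/
  (exists j l (ij : [set i; j] \in E) (il : [set i; l] \in E),
    [/\ j != l, j \in rest x g i, l \in rest x g i &
        val e' = [set vnode ij; vnode il]]).
Proof.
rewrite ffunE => /existsP[u /existsP[v /andP[/eqP -> uv]]] /fintype.subsetP uvi.
have := uvi _ (set21 _ _); have := uvi _ (set22 _ _); move: uv {uvi}.
rewrite !inE /link.
case: u v => -[k [j|]] uE [[m [l|]] vE] //= + /eqP mi /eqP ki;
  subst k m; rewrite eqxx /=.
- by case/and3P => jl jR lR; right; exists j, l, uE, vE.
- by move=> _; left; exists j, uE; apply/setP => z; rewrite !inE -!val_eqE orbC.
- by move=> _; left; exists l, vE; apply/setP => z; rewrite !inE -!val_eqE.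
Qed.

(** * Weights of matchings, and their sum over each fibre of [restr] *)

Section Weights.
Variables (R : realType) (lam : edge E -> R).

(** The number of free neighbors is 1 or 3. If 1, [rest] is empty and only the edge at d_i, of
    weight 1, can occur; if 3, the two elements of [rest] give one more edge, of weight 1/3. *)
Lemma prod_block x g i : (forall i, g i \in free x i) -> odd #|free x i| ->
  \prod_(e' | matching x g e' && (val e' \subset block E i))
    gadget_weight lam e' = #|free x i|%:R^-1.
Proof.
move=> gF Fodd; have Fle : (#|free x i| <= 3)%N.
  by rewrite -(deg_free x i) leq_addl.
have FR : #|free x i| = #|rest x g i|.+1 by rewrite (cardsD1 (g i)) gF.
rewrite FR in Fodd Fle *.
have [R0|[j jR]] := set_0Vmem (rest x g i).
  rewrite R0 cards0 invr1; apply: big1 => e' /andP[/matching_block me' /me'].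
  case=> [[j [ij]]|[j [l [ij [il [_ jR _ _]]]]]]; first exact: gadget_weight_dv.
  by rewrite R0 inE in jR.
have : #|rest x g i| == 2%N.
  have : (0 < #|rest x g i|)%N by apply/card_gt0P; exists j.
  by move: Fodd Fle; case: #|_| => [|[|[|]]].
move=> /cards2P[{jR}{}j [l [jl Rjl]]].
have [jR lR] : j \in rest x g i /\ l \in rest x g i by rewrite Rjl set21 set22.
have [ij il] : [set i; j] \in E /\ [set i; l] \in E.
  by move: jR lR; rewrite !inE => /and3P[_ -> _] /and3P[_ -> _].
have uvl : link x g (vnode ij) (vnode il) by rewrite /link /= eqxx jl jR lR.
pose e0 := mk_edge (link_edge gF uvl).
rewrite (bigD1 e0) /=; last first.
  apply/andP; split.
    by rewrite -(@adjE _ _ _ e0 (vnode ij) (vnode il)) // adj_matching.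
  by apply/fintype.subsetP => z; rewrite !inE => /orP[] /eqP -> /=.
rewrite (gadget_weight_vv lam (ij := ij) (ik := il)) // big1 => [|e'].
  by rewrite mulr1 Rjl cards2 jl div1r.
case/andP => /andP[/matching_block me' /me'].
case=> [[k [ik]]|[k [m [ik [im [km kR mR e'E]]]]]].
  by move=> + _; exact: gadget_weight_dv.
case/eqP; apply/val_inj; rewrite e'E /=.
move: kR mR; rewrite Rjl !inE => /orP[] /eqP ? /orP[] /eqP ?; subst k m.
- by rewrite eqxx in km.
- by congr [set _; _]; apply/val_inj.
- by rewrite finset.setUC; congr [set _; _]; apply/val_inj.
- by rewrite eqxx in km.
Qed.

Lemma prod_matching x g : (forall i, g i \in free x i) ->
  (forall i, odd #|free x i|) ->
  \prod_(e' | matching x g e') gadget_weight lam e' =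
  (\prod_(e | x e) lam e) * \prod_i #|free x i|%:R^-1.
Proof.
move=> gF Fodd; rewrite (bigID (fun e' => [exists e, phi e == e'])) /=.
congr (_ * _).
  rewrite (eq_bigl (mem [set phi e | e in [set e | x e]])) => [|e']; last first.
    apply/andP/imsetP => [[me' /existsP[e /eqP eE]]|[e xe ->]].
      by exists e => //; rewrite inE -(restr_matching gF) ffunE eE.
    split; last by apply/existsP; exists e.
    by move: xe; rewrite inE -{1}(restr_matching gF) ffunE.
  rewrite big_imset => [|e f _ _]; last exact: phi_inj.
  by apply: eq_big => [e|e _]; [rewrite inE|rewrite gadget_weight_phi].
(* The inner product has a single factor, indexed by the block containing [e']; exchanging the two
   products then groups the edges by block. *)
transitivity (\prod_(e' | matching x g e' && ~~ [exists e, phi e == e'])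
    \prod_(i | val e' \subset block E i) gadget_weight lam e').
  apply: eq_bigr => e' /andP[_ /gadget_edgeP[i ie']].
  by rewrite (big_pred1 i).
rewrite (exchange_big_dep xpredT) //=; apply: eq_bigr => i _.
rewrite -(prod_block gF) //; apply: eq_bigl => e'.
rewrite -andbA; congr (_ && _).
case: existsP => // -[e /eqP <-].
by rewrite (negbTE (phi_notin_block _ _)).
Qed.

Lemma sum_w_permat x :
  \sum_(y | restr y == x) w_permat (gadget_weight lam) y =
  w_subs lam (fun=> 0) x.
Proof.
rewrite /w_subs; have [evx|] := boolP [forall i, ~~ odd (deg x i)]; last first.
  (* At a node of odd degree the factor [mu i] is 0, and no perfect matching restricts to [x], so
     both sides vanish. *)
  rewrite negb_forall => /existsP[i]; rewrite negbK => oddi.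
  rewrite (bigD1 i) //= mul0r mulr0 big1 // => y /eqP yx.
  rewrite /w_permat; case: ifP => // /forallP/perfect_link[g [_ /(_ i) + _]].
  have := deg_free x i; rewrite yx => /(congr1 odd); rewrite oddD oddi.
  by move=> /= /negbTE ->.
move/forallP in evx; rewrite [X in _ * X]big1 => [|i oddi]; last first.
  by rewrite (negbTE (evx i)) in oddi.
have Fodd i : odd #|free x i|.
  by have := deg_free x i; move=> /(congr1 odd); rewrite oddD (negbTE (evx i)).
rewrite mulr1 -big_mkcondr /=.
(* The perfect matchings over [x] are parametrized injectively by the choice functions [g] with each
   [g i] free. *)
rewrite (eq_bigl (mem [set matching x g |
    g in family (fun i => mem (free x i))])).
  rewrite big_imset => [|g g' /familyP gF /familyP g'F]; last first.
    exact: matching_inj.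
  rewrite (eq_bigr (fun=> (\prod_(e | x e) lam e) *
      \prod_i #|free x i|%:R^-1)) => [|g /familyP gF]; last first.
    exact: prod_matching.
  (* Distributivity turns the sum over [g] into a product over i of sums over the free neighbors of
     i, each of which is n times 1/n with n odd, hence nonzero. *)
  rewrite -big_distrr /= -(bigA_distr_big_dep _ (fun i _ => #|free x i|%:R^-1)).
  rewrite [X in _ * X]big1 ?mulr1 // => i _.
  rewrite sumr_const -[LHS]mulr_natr mulVf // pnatr_eq0.
  by case: #|_| (Fodd i).
move=> y; apply/andP/imsetP => [[/eqP yx /forallP]|[g /familyP gF ->]].
  case/perfect_link => g [gF _ yg]; rewrite yx in gF yg.
  exists g; first exact/familyP.
  apply/ffunP => e'; have [u [v e'E]] := edge_set2 e' (gadget_simple simpleE).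
  by rewrite -!(adjE _ e'E) adj_matching.
rewrite restr_matching //; split => //; apply/forallP => u.
exact: matching_perfect.
Qed.

(** Summing the fibre identity over all [x] shows that the two normalizing constants agree as
    well. *)
Lemma sum_pi_permat x :
  \sum_(y | restr y == x) pi_permat (gadget_weight lam) y =
  pi_subs lam (fun=> 0) x.
Proof.
rewrite /pi_permat /pi_subs /normalize -big_distrl /= sum_w_permat.
congr (_ / _).
rewrite (partition_big restr xpredT) //=; apply: eq_bigr => z _.
exact: sum_w_permat.
Qed.

End Weights.

End Matchings.

Theorem lemma3 (R : realType) (V : finType) (E : {set {set V}})
    (simpleE : simple_graph E)
    (cubicE : forall i : V, #|neighbors E i| = 3%N)
    (lam : edge E -> R) (lam01 : forall e : edge E, 0 <= lam e <= 1)
    (d : measure_display) (T : measurableType d) (P : probability T R)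
    (X' : T -> config (gadget E)) :
  has_law P X' (pi_permat (gadget_weight lam)) ->
  has_law P (fun t => [ffun e : edge E => X' t (phi e)])
    (pi_subs lam (fun _ : V => 0)).
Proof.
(* [X] is the image of [X'] under [restr], so its masses are the fibre sums just computed. *)
move=> /(has_law_comp (@restr V E)) + s => /(_ s).
by rewrite (sum_pi_permat simpleE cubicE).
Qed.
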